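(* Let $r\in\mathbb{Z}_+$, let $M$ be an irreducible module over the Lie algebra $\mathcal{B}_r$, and let $\lambda\in\mathbb{C}\setminus\{0\}$, $\beta\in\mathbb{C}$. Then the Virasoro module $F(M,\Omega(\lambda,\beta))$ is reducible if and only if $M\cong M_\beta$ as $\mathcal{B}_r$-modules.
   Context: All vector spaces are over $\mathbb{C}$; $\mathbb{Z}_+$ is the set of nonnegative integers and $\mathbb{N}$ the set of positive integers. The Virasoro algebra $\mathcal{V}$ is the complex Lie algebra with basis $\{\mathtt{c},\mathtt{d}_i : i\in\mathbb{Z}\}$ and brackets $[\mathtt{d}_i,\mathtt{d}_j]=(j-i)\mathtt{d}_{i+j}+\delta_{i,-j}\frac{i^3-i}{12}\mathtt{c}$, $[\mathtt{d}_i,\mathtt{c}]=0$ for all $i,j\in\mathbb{Z}$. Let $\mathcal{V}_+$ be the Lie subalgebra of $\mathcal{V}$ spanned by all $\mathtt{d}_i$ with $i\ge 0$. For $r\in\mathbb{Z}_+$ let $\mathcal{V}_+^{(r)}$ be the Lie subalgebra generated by all $\mathtt{d}_i$ with $i>r$, and let $\mathcal{B}_r=\mathcal{V}_+/\mathcal{V}_+^{(r)}$. Write $\bar{\mathtt{d}}_i$ for the image of $\mathtt{d}_i$ in $\mathcal{B}_r$. Thus $\mathcal{B}_r$ has basis $\bar{\mathtt{d}}_0,\dots,\bar{\mathtt{d}}_r$, with $[\bar{\mathtt{d}}_i,\bar{\mathtt{d}}_j]=(j-i)\bar{\mathtt{d}}_{i+j}$, where $\bar{\mathtt{d}}_{i+j}=0$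 if $i+j>r$. For $\gamma\in\mathbb{C}$, $M_\gamma=\mathbb{C}v$ denotes the one-dimensional $\mathcal{B}_r$-module with $\bar{\mathtt{d}}_0v=\gamma v$ and $\bar{\mathtt{d}}_iv=0$ for all $i\in\mathbb{N}$. For $\lambda\in\mathbb{C}\setminus\{0\}$ and $\beta\in\mathbb{C}$, $\Omega(\lambda,\beta)=\mathbb{C}[t]$ as a vector space, with actions of $\mathcal{V}$ and of $\mathcal{A}=\mathbb{C}[x^{\pm1}]$ given by $\mathtt{c}f(t)=0$, $\mathtt{d}_mf(t)=\lambda^m(t-\beta m)f(t-m)$, $x^mf(t)=\lambda^mf(t-m)$ for $m\in\mathbb{Z}$, $f(t)\in\mathbb{C}[t]$. For a $\mathcal{B}_r$-module $M$, $F(M,\Omega(\lambda,\beta))$ is the vector space $M\otimes\Omega(\lambda,\beta)$ with $\mathcal{V}$-module structure: $\mathtt{c}$ acts as $0$ and $$\mathtt{d}_m(v\otimes f(t))=v\otimes\lambda^m(t-m\beta)f(t-m)+\sum_{i=0}^r\frac{m^{i+1}}{(i+1)!}\,\bar{\mathtt{d}}_iv\otimes\lambda^mf(t-m)$$ for $m\in\mathbb{Z}$, $v\in M$, $f(t)\in\mathbb{C}[t]$. A module is reducible if it has a nonzero proper submodule. *)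

(* Defs.v *)
From HB Require Import structures.
From mathcomp Require Import all_boot all_order all_algebra finmap.
From mathcomp Require Import ring_quotient boolp reals complex monalg.
From mathcomp Require Import ring.

Set Implicit Arguments.
Unset Strict Implicit.
Unset Printing Implicit Defensive.

Import Order.TTheory GRing.Theory Num.Theory.
Local Open Scope ring_scope.

HB.mixin Record Lmodule_isLieAlgebra (K : pzRingType) L
    of GRing.Lmodule K L := {
  lie : L -> L -> L;
  lieDZl : forall a x y z, lie (a *: x + y) z = a *: lie x z + lie y z;
  lieDZr : forall a x y z, lie x (a *: y + z) = a *: lie x y + lie x z;
  liexx : forall x, lie x x = 0;
  lie_jacobi : forall x y z,
    lie x (lie y z) + lie y (lie z x) + lie z (lie x y) = 0
}.

#[short(type="lieAlgType")]
HB.structure Definition LieAlgebra (K : pzRingType) :=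
  { L of GRing.Lmodule K L & Lmodule_isLieAlgebra K L }.

HB.mixin Record Lmodule_isLieModule (K : pzRingType) (L : lieAlgType K) M
    of GRing.Lmodule K M := {
  lact : L -> M -> M;
  lactDZl : forall a x y v, lact (a *: x + y) v = a *: lact x v + lact y v;
  lactDZr : forall a x u v, lact x (a *: u + v) = a *: lact x u + lact x v;
  lact_lie : forall x y v,
    lact (lie x y) v = lact x (lact y v) - lact y (lact x v)
}.

#[short(type="lieModType")]
HB.structure Definition LieModule (K : pzRingType) (L : lieAlgType K) :=
  { M of GRing.Lmodule K M & Lmodule_isLieModule K L M }.

Arguments lact {K L M} : rename.

Section LieModules.
Variables (K : pzRingType) (L : lieAlgType K).

Definition lie_submodule (M : lieModType L) (W : M -> Prop) : Prop :=
  [/\ W 0,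
      forall a u v, W u -> W v -> W (a *: u + v)
    & forall x v, W v -> W (lact x v)].

Definition lie_reducible (M : lieModType L) : Prop :=
  exists W : M -> Prop,
    [/\ lie_submodule W, exists2 v, W v & v <> 0 & exists v, ~ W v].

Definition lie_irreducible (M : lieModType L) : Prop :=
  (exists v : M, v <> 0) /\ ~ lie_reducible M.

Definition lie_isomorphic (M N : lieModType L) : Prop :=
  exists f : {linear M -> N},
    bijective f /\ forall x v, f (lact x v) = lact x (f v).

Inductive lin_span (S : L -> Prop) : L -> Prop :=
  | span_in x of S x : lin_span S x
  | span_0 : lin_span S 0
  | span_DZ a x y of lin_span S x & lin_span S y : lin_span S (a *: x + y).

Inductive lie_generated (S : L -> Prop) : L -> Prop :=
  | gen_in x of S x : lie_generated S x
  | gen_0 : lie_generated S 0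
  | gen_DZ a x y of lie_generated S x & lie_generated S y :
      lie_generated S (a *: x + y)
  | gen_lie x y of lie_generated S x & lie_generated S y :
      lie_generated S (lie x y).

End LieModules.

Section LinearExtension.
Variables (K : comNzRingType) (X : choiceType) (W : lmodType K).
Implicit Types (g : X -> W) (x : {malg K[X]}).

Definition mlin g x : W := \sum_(k <- msupp x) x@_k *: g k.

Lemma mlinw (d : {fset X}) g x :
  (msupp x `<=` d)%fset -> mlin g x = \sum_(k <- d) x@_k *: g k.
Proof.
move=> le_xd; rewrite /mlin (big_fset_incl _ le_xd) //= => k _ /mcoeff_outdom ->.
by rewrite scale0r.
Qed.

Lemma mlinDZ g a x y : mlin g (a *: x + y) = a *: mlin g x + mlin g y.
Proof.
pose d := (msupp x `|` msupp y)%fset.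
rewrite !(@mlinw d) ?fsubsetUl ?fsubsetUr //; last first.
  apply: fsubset_trans (msuppD_le _ _) _; apply: fsetSU; exact: msuppZ_le.
rewrite scaler_sumr -big_split; apply: eq_bigr => k _.
by rewrite mcoeffD mcoeffZ scalerDl scalerA.
Qed.

HB.instance Definition _ g := GRing.isLinear.Build K {malg K[X]} W *:%R (mlin g)
  (fun a x y => mlinDZ g a x y).

Lemma mlinU g k : mlin g << k >> = g k.
Proof.
by rewrite (mlinw _ msuppU_le) big_seq_fset1 mcoeffUU scale1r.
Qed.

End LinearExtension.

Lemma malg_ind (K : comNzRingType) (X : choiceType) (P : {malg K[X]} -> Prop) :
    P 0 -> (forall a x y, P x -> P y -> P (a *: x + y)) ->
    (forall k, P << k >>) -> forall x, P x.
Proof.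
move=> P0 PDZ PU x; rewrite [x]monalgE.
elim/big_rec: _ => // k y _ Py.
have -> : << x@_k *g k >> = x@_k *: << k >> :> {malg K[X]}.
  by apply/malgP => j; rewrite mcoeffZ !mcoeffU mulrnAr mulr1.
exact: PDZ.
Qed.

Section Tensor.
Variables (K : comNzRingType) (M N : lmodType K).
Local Notation free := {malg K[(M * N)%type]}.

Inductive tensor_rel : free -> Prop :=
  | tensor_relDZl a u v w : tensor_rel
      (<< (a *: u + v, w) >> - (a *: << (u, w) >> + << (v, w) >>))
  | tensor_relDZr a u v w : tensor_rel
      (<< (u, a *: v + w) >> - (a *: << (u, v) >> + << (u, w) >>))
  | tensor_rel0 : tensor_rel 0
  | tensor_relDZ a x y of tensor_rel x & tensor_rel y :
      tensor_rel (a *: x + y).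

Definition tensor_relb : {pred free} := fun x => `[< tensor_rel x >].

Lemma tensor_relbP x : reflect (tensor_rel x) (x \in tensor_relb).
Proof. exact: asboolP. Qed.

Lemma tensor_relb_zmod : zmod_closed tensor_relb.
Proof.
split=> [|x y /tensor_relbP Rx /tensor_relbP Ry]; apply/tensor_relbP.
  exact: tensor_rel0.
by rewrite addrC -scaleN1r; apply: tensor_relDZ.
Qed.

HB.instance Definition _ := GRing.isZmodClosed.Build free tensor_relb
  tensor_relb_zmod.

Definition tensor : Type := Quotient.quot tensor_relb.
HB.instance Definition _ := GRing.Zmodule.on tensor.

Definition tensor_pi (x : free) : tensor := \pi_(Quotient.quot tensor_relb)%qT x.

Lemma tensor_piP x y : tensor_rel (x - y) <-> tensor_pi x = tensor_pi y.
Proof.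
split=> [/tensor_relbP|].
  by rewrite Quotient.idealrBE => /eqP.
by move=> /eqP; rewrite -Quotient.idealrBE => /tensor_relbP.
Qed.

Definition tensor_repr (q : tensor) : free := generic_quotient.repr q.

Lemma tensor_reprK q : tensor_pi (tensor_repr q) = q.
Proof. exact: generic_quotient.reprK. Qed.

Lemma tensor_piD x y : tensor_pi (x + y) = tensor_pi x + tensor_pi y.
Proof. exact: (raddfD (\pi_(Quotient.quot tensor_relb)%qT)). Qed.

Definition tensor_scale a q : tensor := tensor_pi (a *: tensor_repr q).

Lemma tensor_piZ a x : tensor_scale a (tensor_pi x) = tensor_pi (a *: x).
Proof.
apply/tensor_piP; rewrite -scalerBr -[_ *: _]addr0.
by apply: tensor_relDZ (tensor_rel0); apply/tensor_piP; rewrite tensor_reprK.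
Qed.

Lemma tensor_scaleA a b q :
  tensor_scale a (tensor_scale b q) = tensor_scale (a * b) q.
Proof. by rewrite -[q]tensor_reprK !tensor_piZ scalerA. Qed.
Lemma tensor_scale1 : left_id 1 tensor_scale.
Proof. by move=> q; rewrite -[q]tensor_reprK !tensor_piZ scale1r. Qed.
Lemma tensor_scaleDr : right_distributive tensor_scale +%R.
Proof.
move=> a p q; rewrite -[p]tensor_reprK -[q]tensor_reprK -tensor_piD !tensor_piZ.
by rewrite -tensor_piD scalerDr.
Qed.
Lemma tensor_scaleDl q : {morph tensor_scale^~ q : a b / a + b}.
Proof.
by move=> a b; rewrite -[q]tensor_reprK !tensor_piZ -tensor_piD scalerDl.
Qed.

HB.instance Definition _ := GRing.Zmodule_isLmodule.Build K tensor
  tensor_scaleA tensor_scale1 tensor_scaleDr tensor_scaleDl.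

Definition tens (u : M) (w : N) : tensor := tensor_pi << (u, w) >>.

Lemma tensor_piDZ a x y :
  tensor_pi (a *: x + y) = a *: tensor_pi x + tensor_pi y.
Proof. by rewrite tensor_piD -tensor_piZ. Qed.

Lemma tensDZl a u v w : tens (a *: u + v) w = a *: tens u w + tens v w.
Proof. by rewrite -tensor_piDZ; apply/tensor_piP/tensor_relDZl. Qed.

Lemma tensDZr a u v w : tens u (a *: v + w) = a *: tens u v + tens u w.
Proof. by rewrite -tensor_piDZ; apply/tensor_piP/tensor_relDZr. Qed.

Lemma tensor_ind (P : tensor -> Prop) :
  P 0 -> (forall a p q, P p -> P q -> P (a *: p + q)) ->
  (forall u w, P (tens u w)) -> forall q, P q.
Proof.
move=> P0 PDZ PU q; rewrite -[q]tensor_reprK.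
elim/malg_ind: (tensor_repr q) => [|a x y Px Py|[u w]]; last exact: PU.
- suff -> : tensor_pi 0 = 0 by [].
  by apply: (addrI (tensor_pi 0)); rewrite -tensor_piD !addr0.
- by rewrite tensor_piDZ; apply: PDZ.
Qed.

Definition bilinear_map (W : lmodType K) (b : M -> N -> W) : Prop :=
  (forall a u v w, b (a *: u + v) w = a *: b u w + b v w) /\
  (forall a u v w, b u (a *: v + w) = a *: b u v + b u w).

(* Only meaningful when b is bilinear, see tlift_tens. *)
Definition tlift (W : lmodType K) (b : M -> N -> W) (q : tensor) : W :=
  mlin (fun p => b p.1 p.2) (tensor_repr q).

Section Lift.
Variables (W : lmodType K) (b : M -> N -> W).
Hypothesis b_bilin : bilinear_map b.

Let tlift_pi x : tlift b (tensor_pi x) = mlin (fun p => b p.1 p.2) x.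
Proof.
apply/eqP; rewrite -subr_eq0 -raddfB; apply/eqP.
have /tensor_piP: tensor_pi (tensor_repr (tensor_pi x)) = tensor_pi x.
  exact: tensor_reprK.
elim=> [a u v w|a u v w||a y z _ IHy _ IHz].
- by rewrite raddfB /= mlinDZ !mlinU /= b_bilin.1 subrr.
- by rewrite raddfB /= mlinDZ !mlinU /= b_bilin.2 subrr.
- exact: raddf0.
- by rewrite /= mlinDZ IHy IHz scaler0 addr0.
Qed.

Lemma tlift_tens u w : tlift b (tens u w) = b u w.
Proof. by rewrite tlift_pi mlinU. Qed.

Lemma tliftDZ a p q : tlift b (a *: p + q) = a *: tlift b p + tlift b q.
Proof.
by rewrite -[p]tensor_reprK -[q]tensor_reprK -tensor_piDZ !tlift_pi mlinDZ.
Qed.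

End Lift.

End Tensor.

Section LieConstructionLemmas.
Variables (K : numFieldType) (L : lmodType K).

Lemma alternating_of_anti (b : L -> L -> L) :
  (forall x y, b x y = - b y x) -> forall x, b x x = 0.
Proof.
move=> anti x; have := anti x x => /eqP; rewrite -addr_eq0 -mulr2n -scaler_nat.
by rewrite scaler_eq0 pnatr_eq0 => /eqP.
Qed.

Lemma sum3_lin (a : K) (x y z u v w : L) :
  x + y + z = 0 -> u + v + w = 0 ->
  (a *: x + u) + (a *: y + v) + (a *: z + w) = 0.
Proof.
move=> xyz0 uvw0.
rewrite (addrACA (a *: x)) -scalerDr (addrACA (a *: (x + y))) -scalerDr.
by rewrite xyz0 uvw0 scaler0 addr0.
Qed.

Lemma sum3_comb (a a' b b' c c' : K) (x y : L) :
  a + b + c = 0 -> a' + b' + c' = 0 ->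
  (a *: x + a' *: y) + (b *: x + b' *: y) + (c *: x + c' *: y) = 0.
Proof.
move=> abc0 abc0'.
rewrite (addrACA (a *: x)) -!scalerDl (addrACA ((a + b) *: x)) -!scalerDl.
by rewrite abc0 abc0' !scale0r addr0.
Qed.

(* A bilinear bracket satisfies the Jacobi identity as soon as it does on a
   generating set of vectors d. *)
Lemma jacobi_of_basis (I : Type) (d : I -> L) (b : L -> L -> L) :
  (forall a x y z, b (a *: x + y) z = a *: b x z + b y z) ->
  (forall a x y z, b x (a *: y + z) = a *: b x y + b x z) ->
  (forall P : L -> Prop, P 0 ->
    (forall a x y, P x -> P y -> P (a *: x + y)) -> (forall i, P (d i)) ->
    forall x, P x) ->
  (forall i j k, b (d i) (b (d j) (d k)) + b (d j) (b (d k) (d i))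
               + b (d k) (b (d i) (d j)) = 0) ->
  forall x y z, b x (b y z) + b y (b z x) + b z (b x y) = 0.
Proof.
move=> bl br dind bd x y z.
have b0l u : b 0 u = 0.
  by have := bl (-1) 0 0 u; rewrite scaler0 addr0 scaleN1r addNr.
have b0r u : b u 0 = 0.
  by have := br (-1) u 0 0; rewrite scaler0 addr0 scaleN1r addNr.
elim/dind: x => [|a x x' Hx Hx'|i]; first by rewrite !(b0l, b0r) !addr0.
  by rewrite !(bl, br); apply: sum3_lin.
elim/dind: y => [|a y y' Hy Hy'|j]; first by rewrite !(b0l, b0r) !addr0.
  by rewrite !(bl, br); apply: sum3_lin.
elim/dind: z => [|a z z' Hz Hz'|k]; first by rewrite !(b0l, b0r) !addr0.
  by rewrite !(bl, br); apply: sum3_lin.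
exact: bd.
Qed.

Lemma anti_of_basis (I : Type) (d : I -> L) (b : L -> L -> L) :
  (forall a x y z, b (a *: x + y) z = a *: b x z + b y z) ->
  (forall a x y z, b x (a *: y + z) = a *: b x y + b x z) ->
  (forall P : L -> Prop, P 0 ->
    (forall a x y, P x -> P y -> P (a *: x + y)) -> (forall i, P (d i)) ->
    forall x, P x) ->
  (forall i j, b (d i) (d j) = - b (d j) (d i)) ->
  forall x y, b x y = - b y x.
Proof.
move=> bl br dind bd x y.
have b0l u : b 0 u = 0.
  by have := bl (-1) 0 0 u; rewrite scaler0 addr0 scaleN1r addNr.
have b0r u : b u 0 = 0.
  by have := br (-1) u 0 0; rewrite scaler0 addr0 scaleN1r addNr.
elim/dind: x => [|a x x' Hx Hx'|i]; first by rewrite b0l b0r oppr0.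
  by rewrite bl br Hx Hx' opprD scalerN.
elim/dind: y => [|a y y' Hy Hy'|j]; first by rewrite b0l b0r oppr0.
  by rewrite bl br Hy Hy' opprD scalerN.
exact: bd.
Qed.

End LieConstructionLemmas.

Section Virasoro.
Variable K : numFieldType.

(* The index Some i stands for d_i and the index None for c. *)
Definition virasoro : Type := {malg K[option int]}.
HB.instance Definition _ := GRing.Lmodule.on virasoro.

Definition vd (i : int) : virasoro := << Some i >>.
Definition vc : virasoro := << None >>.

Definition vir_lie_basis (p q : option int) : virasoro :=
  match p, q with
  | Some i, Some j =>
      (j - i)%:~R *: vd (i + j)
      + ((i == - j)%:R * ((i ^+ 3 - i)%:~R / 12%:R)) *: vc
  | _, _ => 0
  end.

Definition vir_lie (x y : virasoro) : virasoro :=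
  mlin (fun p => mlin (vir_lie_basis p) y) x.

Lemma vir_lieDZl a x y z :
  vir_lie (a *: x + y) z = a *: vir_lie x z + vir_lie y z.
Proof. exact: mlinDZ. Qed.

Lemma vir_lieDZr a x y z :
  vir_lie x (a *: y + z) = a *: vir_lie x y + vir_lie x z.
Proof.
rewrite /vir_lie [in RHS]/mlin scaler_sumr -big_split; apply: eq_bigr => p _.
by rewrite mlinDZ scalerDr !scalerA mulrC.
Qed.

Lemma vir_lieE p q : vir_lie << p >> << q >> = vir_lie_basis p q.
Proof. by rewrite /vir_lie !mlinU. Qed.

Lemma vir_lie_anti x y : vir_lie x y = - vir_lie y x.
Proof.
apply: (anti_of_basis vir_lieDZl vir_lieDZr (@malg_ind _ _)) => p q.
rewrite !vir_lieE; case: p q => [i|] [j|] /=; rewrite ?oppr0 //.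
rewrite opprD -[- (_ *: vd _)]scaleNr -[- (_ *: vc)]scaleNr [j + i]addrC.
have comb a a' b b' (u v : virasoro) : a = a' -> b = b' ->
  a *: u + b *: v = a' *: u + b' *: v by move=> -> ->.
apply: comb.
  by ring.
rewrite -eqr_oppLR [j == _]eq_sym; case: eqP => [<-|_]; last by rewrite !mul0r oppr0.
by field.
Qed.

Lemma vir_lie_jacobi x y z :
  vir_lie x (vir_lie y z) + vir_lie y (vir_lie z x)
  + vir_lie z (vir_lie x y) = 0.
Proof.
have l0 u : vir_lie u 0 = 0.
  by have := vir_lieDZr (-1) u 0 0; rewrite scaler0 addr0 scaleN1r addNr.
have lZ a u v : vir_lie u (a *: v) = a *: vir_lie u v.
  by rewrite -[a *: v]addr0 vir_lieDZr l0 addr0.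
have cl u : vir_lie vc u = 0 by rewrite /vir_lie mlinU /mlin big1 // => ? _; exact: scaler0.
have cr u : vir_lie u vc = 0 by rewrite vir_lie_anti cl oppr0.
have sum0 : 0 + 0 + 0 = 0 :> virasoro by rewrite !addr0.
have dd i j k : vir_lie (vd i) (vir_lie (vd j) (vd k)) =
    ((k - j)%:~R * (j + k - i)%:~R) *: vd (i + (j + k))
    + ((k - j)%:~R * ((i == - (j + k))%:R * ((i ^+ 3 - i)%:~R / 12%:R))) *: vc.
  rewrite (vir_lieE (Some j)) /= vir_lieDZr lZ cr scaler0 addr0 vir_lieE /=.
  by rewrite scalerDr !scalerA.
apply: (jacobi_of_basis vir_lieDZl vir_lieDZr (@malg_ind _ _)) => p q s.
case: p => [i|]; last by rewrite cl (cr << s >>) (cl << q >>) !l0 sum0.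
case: q => [j|]; last by rewrite (cl << s >>) cl (cr << Some i >>) !l0 sum0.
case: s => [k|]; last by rewrite (cr << Some j >>) (cl << Some i >>) cl !l0 sum0.
rewrite (dd i) (dd j) (dd k).
have -> : j + (k + i) = i + (j + k) by ring.
have -> : k + (i + j) = i + (j + k) by ring.
apply: sum3_comb; first by ring.
have -> : (j == - (k + i)) = (i == - (j + k)).
  by apply/eqP/eqP => [->|->]; ring.
have -> : (k == - (i + j)) = (i == - (j + k)).
  by apply/eqP/eqP => [->|->]; ring.
case: eqP => [->|_]; last by rewrite !mul0r !mulr0 !addr0.
by field.
Qed.

HB.instance Definition _ := Lmodule_isLieAlgebra.Build K virasoro
  vir_lieDZl vir_lieDZr (alternating_of_anti vir_lie_anti) vir_lie_jacobi.

End Virasoro.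

Arguments vd {K}.
Arguments vc {K}.

Section Br.
Variables (K : numFieldType) (r : nat).

(* Coordinates with respect to the basis d_0, ..., d_r. *)
Definition Br : Type := 'rV[K]_r.+1.
HB.instance Definition _ := GRing.Lmodule.on Br.

(* The image of d_k for any k : nat; it vanishes when r < k. *)
Definition Br_d (k : nat) : Br := \row_(j < r.+1) (j == k :> nat)%:R.

Definition Br_coord (x : Br) (i : 'I_r.+1) : K := (x : 'rV[K]_r.+1) 0 i.

Definition Br_lie (x y : Br) : Br :=
  \sum_(i < r.+1) \sum_(j < r.+1)
    (Br_coord x i * Br_coord y j * (j%:Z - i%:Z)%:~R) *: Br_d (i + j).

Lemma Br_coordDZ a x y i :
  Br_coord (a *: x + y) i = a * Br_coord x i + Br_coord y i.
Proof. by rewrite /Br_coord !mxE. Qed.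

Lemma Br_coordP x y : (forall i, Br_coord x i = Br_coord y i) -> x = y.
Proof. by move=> xy; apply/rowP => i; apply: xy. Qed.

Lemma Br_coord_d k i : Br_coord (Br_d k) i = (i == k :> nat)%:R.
Proof. by rewrite /Br_coord mxE. Qed.

Lemma Br_d0 k : (r < k)%N -> Br_d k = 0.
Proof.
move=> rk; apply: Br_coordP => i; rewrite Br_coord_d /Br_coord mxE.
by rewrite ltn_eqF // (leq_trans _ rk).
Qed.

Lemma Br_coord_sum (I : Type) (s : seq I) (P : pred I) (F : I -> Br) i :
  Br_coord (\sum_(k <- s | P k) F k) i = \sum_(k <- s | P k) Br_coord (F k) i.
Proof. by rewrite /Br_coord summxE. Qed.

Lemma Br_sum_d x : x = \sum_(i < r.+1) Br_coord x i *: Br_d i.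
Proof.
apply: Br_coordP => i; rewrite Br_coord_sum (bigD1 i) //= big1 ?addr0.
  by rewrite /Br_coord !mxE eqxx mulr1.
move=> j ji; rewrite /Br_coord !mxE -[_ == _ :> nat]/(i == j).
by rewrite eq_sym (negPf ji) mulr0.
Qed.

Lemma Br_ind (P : Br -> Prop) :
  P 0 -> (forall a x y, P x -> P y -> P (a *: x + y)) ->
  (forall k, P (Br_d k)) -> forall x, P x.
Proof.
move=> P0 PDZ Pd x; rewrite [x]Br_sum_d; elim/big_rec: _ => // i y _.
exact: PDZ.
Qed.

Lemma Br_lieDZl a x y z : Br_lie (a *: x + y) z = a *: Br_lie x z + Br_lie y z.
Proof.
rewrite /Br_lie scaler_sumr -big_split; apply: eq_bigr => i _.
rewrite scaler_sumr -big_split; apply: eq_bigr => j _ /=.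
by rewrite scalerA -scalerDl Br_coordDZ !mulrDl !mulrA.
Qed.

Lemma Br_lieDZr a x y z : Br_lie x (a *: y + z) = a *: Br_lie x y + Br_lie x z.
Proof.
rewrite /Br_lie scaler_sumr -big_split; apply: eq_bigr => i _.
rewrite scaler_sumr -big_split; apply: eq_bigr => j _ /=.
by rewrite scalerA -scalerDl Br_coordDZ mulrDr mulrDl mulrCA !mulrA.
Qed.

Lemma Br_lieE i j : Br_lie (Br_d i) (Br_d j) = (j%:Z - i%:Z)%:~R *: Br_d (i + j).
Proof.
rewrite /Br_lie; case: (ltnP r i) => [ri|ir].
  rewrite (Br_d0 (ltn_addr _ ri)) scaler0 big1 // => k _; rewrite big1 // => l _.
  by rewrite Br_coord_d ltn_eqF ?(leq_trans (ltn_ord k)) // !mul0r scale0r.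
rewrite (bigD1 (Ordinal (ir : i < r.+1)%N)) //= [X in _ + X]big1 ?addr0; last first.
  move=> k /eqP ki; rewrite big1 // => l _; rewrite Br_coord_d.
  by case: eqP => [ki'|_]; [case: ki; apply: val_inj | rewrite !mul0r scale0r].
case: (ltnP r j) => [rj|jr].
  rewrite (Br_d0 (ltn_addl _ rj)) scaler0 big1 // => l _.
  by rewrite !Br_coord_d (ltn_eqF (leq_trans (ltn_ord l) _)) // mulr0 mul0r scale0r.
rewrite (bigD1 (Ordinal (jr : j < r.+1)%N)) //= big1 ?addr0; last first.
  move=> k /eqP kj; rewrite !Br_coord_d.
  by case: (eqVneq (k : nat) j) => [kj'|_]; [case: kj; apply: val_inj | rewrite mulr0 mul0r scale0r].
by rewrite !Br_coord_d !eqxx !mul1r.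
Qed.

Lemma Br_lie_anti x y : Br_lie x y = - Br_lie y x.
Proof.
apply: (anti_of_basis Br_lieDZl Br_lieDZr Br_ind) => i j.
by rewrite !Br_lieE -scaleNr addnC -rmorphN opprB.
Qed.

Lemma Br_lie_jacobi x y z :
  Br_lie x (Br_lie y z) + Br_lie y (Br_lie z x) + Br_lie z (Br_lie x y) = 0.
Proof.
have l0 u : Br_lie u 0 = 0.
  by have := Br_lieDZr (-1) u 0 0; rewrite scaler0 addr0 scaleN1r addNr.
have lZ a u v : Br_lie u (a *: v) = a *: Br_lie u v.
  by rewrite -[a *: v]addr0 Br_lieDZr l0 addr0.
apply: (jacobi_of_basis Br_lieDZl Br_lieDZr Br_ind) => i j k.
rewrite !Br_lieE !lZ !Br_lieE !scalerA.
rewrite (_ : j + (k + i) = i + (j + k))%N; last first.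
  by rewrite addnCA addnC addnAC addnA addnC addnA.
rewrite (_ : k + (i + j) = i + (j + k))%N; last by rewrite addnCA [(k + j)%N]addnC.
rewrite -!scalerDl !PoszD -[RHS](scale0r (Br_d (i + (j + k)))).
by congr (_ *: _); ring.
Qed.

HB.instance Definition _ := Lmodule_isLieAlgebra.Build K Br
  Br_lieDZl Br_lieDZr (alternating_of_anti Br_lie_anti) Br_lie_jacobi.

End Br.

Arguments Br_d {K r}.

(* Br_quotient says that Br K r is the quotient of the Lie algebra
   V_+ = span (d_i, i >= 0) by its subalgebra generated by the d_i, i > r. *)

Section BrQuotient.
Variables (K : numFieldType) (r : nat).
Local Notation V := (virasoro K).

Definition Vplus : V -> Prop := lin_span (fun x => exists n : nat, x = vd n).

Definition Vplus_r : V -> Prop :=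
  lie_generated (fun x => exists2 n : nat, (r < n)%N & x = vd n).

Definition Br_proj : V -> Br K r :=
  mlin (fun p => if p is Some (Posz n) then Br_d n else 0).

Lemma Br_projDZ a x y : Br_proj (a *: x + y) = a *: Br_proj x + Br_proj y.
Proof. exact: mlinDZ. Qed.

Lemma Br_proj_d (n : nat) : Br_proj (vd n) = Br_d n.
Proof. by rewrite /Br_proj mlinU. Qed.

Lemma vd_lie_nat (m n : nat) :
  lie (vd m : V) (vd n) = (n%:Z - m%:Z)%:~R *: vd (m + n)%N.
Proof.
rewrite [LHS]vir_lieE /= -PoszD.
suff -> : (m%:Z == - n%:Z)%:R * ((m%:Z ^+ 3 - m%:Z)%:~R / 12%:R) = 0 :> K.
  by rewrite scale0r addr0.
case: eqP => [mn|_]; last by rewrite mul0r.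
have -> : m = 0%N by case: n mn => [|n]; case: m.
by rewrite expr0n subr0 mul0r mulr0.
Qed.

Lemma lie0l (L : lieAlgType K) (x : L) : lie 0 x = 0.
Proof. by have := lieDZl (-1) 0 0 x; rewrite scaler0 addr0 scaleN1r addNr. Qed.
Lemma lie0r (L : lieAlgType K) (x : L) : lie x 0 = 0.
Proof. by have := lieDZr (-1) x 0 0; rewrite scaler0 addr0 scaleN1r addNr. Qed.

Lemma Vplus_lie x y : Vplus x -> Vplus y -> Vplus (lie x y).
Proof.
move=> Vx Vy; elim: Vx => [_ [m ->]||a u v _ IHu _ IHv]; last 2 first.
- by rewrite lie0l; apply: span_0.
- by rewrite lieDZl; apply: span_DZ.
elim: Vy => [_ [n ->]||a u v _ IHu _ IHv]; last 2 first.
- by rewrite lie0r; apply: span_0.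
- by rewrite lieDZr; apply: span_DZ.
rewrite vd_lie_nat -[_ *: _]addr0; apply: span_DZ; last exact: span_0.
by apply: span_in; exists (m + n)%N.
Qed.

Lemma Br_proj0 : Br_proj 0 = 0.
Proof. exact: raddf0. Qed.

Lemma Br_proj_lie x y :
  Vplus x -> Vplus y -> Br_proj (lie x y) = lie (Br_proj x) (Br_proj y).
Proof.
move=> Vx Vy; elim: Vx => [_ [m ->]||a u v _ IHu _ IHv]; last 2 first.
- by rewrite lie0l Br_proj0 lie0l.
- by rewrite lieDZl !Br_projDZ IHu IHv lieDZl.
elim: Vy => [_ [n ->]||a u v _ IHu _ IHv]; last 2 first.
- by rewrite lie0r Br_proj0 lie0r.
- by rewrite lieDZr !Br_projDZ IHu IHv lieDZr.
rewrite vd_lie_nat -[_ *: _]addr0 Br_projDZ Br_proj0 addr0 !Br_proj_d.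
exact/esym/Br_lieE.
Qed.

Lemma Br_proj_surj z : exists2 x, Vplus x & Br_proj x = z.
Proof.
elim/Br_ind: z => [|a _ _ [x Vx <-] [y Vy <-]|k].
- by exists 0; [apply: span_0 | apply: Br_proj0].
- by exists (a *: x + y); [apply: span_DZ | rewrite Br_projDZ].
- by exists (vd k); [apply: span_in; exists k | rewrite Br_proj_d].
Qed.

Lemma Vplus_r_Vplus x : Vplus_r x -> Vplus x.
Proof.
elim=> [_ [n _ ->]||a u v _ Vu _ Vv|u v _ Vu _ Vv].
- by apply: span_in; exists n.
- exact: span_0.
- exact: span_DZ.
- exact: Vplus_lie.
Qed.

Lemma Br_proj_ker x : Vplus x -> (Br_proj x = 0 <-> Vplus_r x).
Proof.
move=> Vx; split=> [x0|]; last first.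
  elim=> {Vx x} [_ [n rn ->]||a u v _ Hu _ Hv|u v Vu Hu Vv Hv].
  - by rewrite Br_proj_d Br_d0.
  - exact: Br_proj0.
  - by rewrite Br_projDZ Hu Hv scaler0 addr0.
  - by rewrite Br_proj_lie ?Hu ?lie0l //; apply: Vplus_r_Vplus.
pose s (z : Br K r) : V := \sum_(i < r.+1) Br_coord z i *: vd i.
suff : Vplus_r (x - s (Br_proj x)).
  rewrite x0 /s big1 ?subr0 // => i _; rewrite /Br_coord mxE; exact: scale0r.
have sDZ a u v : s (a *: u + v) = a *: s u + s v.
  rewrite /s scaler_sumr -big_split; apply: eq_bigr => i _ /=.
  by rewrite Br_coordDZ scalerDl scalerA.
elim: {x0} Vx => [_ [n ->]||a u v _ Hu _ Hv].
- rewrite Br_proj_d; case: (ltnP r n) => rn.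
    rewrite Br_d0 // /s big1 ?subr0; first by apply: gen_in; exists n.
    by move=> i _; rewrite /Br_coord mxE; exact: scale0r.
  suff -> : s (Br_d n) = vd n by rewrite subrr; apply: gen_0.
  rewrite /s (bigD1 (Ordinal (rn : n < r.+1)%N)) //= Br_coord_d eqxx scale1r.
  rewrite big1 ?addr0 // => i /eqP ni; rewrite Br_coord_d.
  by case: eqP => [ni'|_]; [case: ni; apply: val_inj | exact: scale0r].
- rewrite Br_proj0 sub0r /s big1 ?oppr0; first exact: gen_0.
  by move=> i _; rewrite /Br_coord mxE; exact: scale0r.
- rewrite Br_projDZ sDZ opprD addrACA -scalerBr; exact: gen_DZ.
Qed.

Theorem Br_quotient :
  [/\ forall a x y, Br_proj (a *: x + y) = a *: Br_proj x + Br_proj y,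
      forall x y, Vplus x -> Vplus y ->
        Vplus (lie x y) /\ Br_proj (lie x y) = lie (Br_proj x) (Br_proj y),
      forall z, exists2 x, Vplus x & Br_proj x = z
    & forall x, Vplus_r x <-> Vplus x /\ Br_proj x = 0].
Proof.
split; [exact: Br_projDZ | | exact: Br_proj_surj |] => [x y Vx Vy|x].
  by split; [apply: Vplus_lie | apply: Br_proj_lie].
split=> [Rx|[Vx x0]]; last exact/Br_proj_ker.
by split; [|apply/Br_proj_ker]; rewrite //; apply: Vplus_r_Vplus.
Qed.

End BrQuotient.

(* The parameters r and gamma are only used by the action. *)
Definition Mgamma (K : numFieldType) (r : nat) (gamma : K) : Type := K^o.

Section Mgamma.
Variables (K : numFieldType) (r : nat) (gamma : K).
Local Notation Mgamma := (@Mgamma K r gamma).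

HB.instance Definition _ := GRing.Lmodule.on Mgamma.

Definition Mgamma_act (x : Br K r) (v : Mgamma) : Mgamma :=
  (gamma * Br_coord x ord0) *: v.

Lemma Mgamma_actDZl a x y v :
  Mgamma_act (a *: x + y) v = a *: Mgamma_act x v + Mgamma_act y v.
Proof. by rewrite /Mgamma_act Br_coordDZ scalerA -scalerDl mulrDr mulrCA. Qed.

Lemma Mgamma_actDZr a x u v :
  Mgamma_act x (a *: u + v) = a *: Mgamma_act x u + Mgamma_act x v.
Proof. by rewrite /Mgamma_act scalerDr !scalerA mulrC. Qed.

Lemma Br_lie_coord0 (x y : Br K r) : Br_coord (lie x y) ord0 = 0.
Proof.
have -> : lie x y = Br_lie x y by [].
rewrite Br_coord_sum big1 // => i _.
rewrite Br_coord_sum big1 // => j _; rewrite -[_ *: _]addr0 Br_coordDZ Br_coord_d.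
rewrite [Br_coord 0 _]mxE addr0 /= eq_sym addn_eq0.
by case: andP => [[/eqP -> /eqP ->]|_]; rewrite ?subrr !mulr0 ?mul0r.
Qed.

Lemma Mgamma_act_lie x y v :
  Mgamma_act (lie x y) v = Mgamma_act x (Mgamma_act y v) - Mgamma_act y (Mgamma_act x v).
Proof.
rewrite /Mgamma_act Br_lie_coord0 !scalerA [X in X *: v - _]mulrC subrr.
by rewrite mulr0 scale0r.
Qed.

HB.instance Definition _ := Lmodule_isLieModule.Build K (Br K r) Mgamma
  Mgamma_actDZl Mgamma_actDZr Mgamma_act_lie.

Lemma Mgamma_d0 (v : Mgamma) : lact (Br_d 0 : Br K r) v = gamma *: v.
Proof.
by rewrite [LHS](_ : _ = Mgamma_act (Br_d 0) v) // /Mgamma_act Br_coord_d mulr1.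
Qed.

Lemma Mgamma_d (i : nat) (v : Mgamma) :
  (0 < i)%N -> lact (Br_d i : Br K r) v = 0.
Proof.
move=> i0; rewrite [LHS](_ : _ = Mgamma_act (Br_d i) v) // /Mgamma_act.
by rewrite Br_coord_d ltn_eqF // mulr0 scale0r.
Qed.

End Mgamma.

Arguments Mgamma {K} r gamma.

Section Omega.
Variables (K : numFieldType) (lambda beta : K).
Implicit Types f g : {poly K}.

(* shift m f is f(t - m), with t written 'X. *)
Definition shift (m : int) f : {poly K} := f \Po ('X - (m%:~R)%:P).

(* The actions of x^m and d_m on Omega(lambda, beta) = K[t]. *)
Definition Omega_x (m : int) f : {poly K} := lambda ^ m *: shift m f.

Definition Omega_d (m : int) f : {poly K} :=
  lambda ^ m *: (('X - (m%:~R * beta)%:P) * shift m f).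

Lemma shiftDZ m a f g : shift m (a *: f + g) = a *: shift m f + shift m g.
Proof. by rewrite /shift comp_polyD comp_polyZ. Qed.

Lemma shiftM m f g : shift m (f * g) = shift m f * shift m g.
Proof. exact: rmorphM. Qed.

Lemma shift_shift m n f : shift m (shift n f) = shift (m + n) f.
Proof.
rewrite /shift -comp_polyA comp_polyB comp_polyX comp_polyC; congr (_ \Po _).
by rewrite rmorphD polyCD opprD addrA.
Qed.

Lemma Omega_xDZ m a f g :
  Omega_x m (a *: f + g) = a *: Omega_x m f + Omega_x m g.
Proof. by rewrite /Omega_x shiftDZ scalerDr !scalerA mulrC. Qed.

Lemma Omega_dDZ m a f g :
  Omega_d m (a *: f + g) = a *: Omega_d m f + Omega_d m g.
Proof.
by rewrite /Omega_d shiftDZ mulrDr scalerDr -scalerAr !scalerA mulrC.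
Qed.

Lemma Omega_dE m f :
  Omega_d m f = ('X - (m%:~R * beta)%:P) * Omega_x m f.
Proof. by rewrite /Omega_d /Omega_x scalerAr. Qed.

Hypothesis lambda0 : lambda != 0.

Lemma Omega_xx m n f : Omega_x m (Omega_x n f) = Omega_x (m + n) f.
Proof.
rewrite /Omega_x -[lambda ^ n *: _]addr0 shiftDZ shift_shift.
by rewrite [shift m 0]comp_poly0 addr0 scalerA expfzDr.
Qed.

Lemma shiftX m c : shift m ('X - c%:P) = 'X - m%:~R%:P - c%:P.
Proof. by rewrite /shift comp_polyB comp_polyX comp_polyC. Qed.

Lemma Omega_xd m n f :
  Omega_x m (Omega_d n f)
  = ('X - m%:~R%:P - (n%:~R * beta)%:P) * Omega_x (m + n) f.
Proof.
rewrite Omega_dE -Omega_xx {1}/Omega_x shiftM shiftX.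
by rewrite [in RHS]/Omega_x scalerAr.
Qed.

Lemma Omega_dx m n f :
  Omega_d m (Omega_x n f) = ('X - (m%:~R * beta)%:P) * Omega_x (m + n) f.
Proof. by rewrite Omega_dE Omega_xx. Qed.

Lemma Omega_dd m n f :
  Omega_d m (Omega_d n f) - Omega_d n (Omega_d m f)
  = (n - m)%:~R *: Omega_d (m + n) f.
Proof.
rewrite !(Omega_dE _ (Omega_d _ _)) !Omega_xd [n + m]addrC Omega_dE.
rewrite -mul_polyC; ring.
Qed.

End Omega.

(* F(M, Omega(lambda, beta)); its action is given by Fmod_vd and Fmod_vc below.
   Only the action depends on lambda and beta; lambda != 0 is what makes the
   module axioms hold. *)
Definition Fmod (K : numFieldType) (r : nat) (M : lieModType (Br K r))
  (lambda beta : K) (lambda0 : lambda != 0) : Type := tensor M {poly K}.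

Section Fmod.
Variables (K : numFieldType) (r : nat) (M : lieModType (Br K r)).
Variables (lambda beta : K).
Implicit Types (v : M) (f : {poly K}).

Definition F_d_tens (m : int) v f : tensor M {poly K} :=
  tens v (Omega_d lambda beta m f)
  + \sum_(i < r.+1)
      (m%:~R ^+ i.+1 / (i.+1)`!%:R) *: tens (lact (Br_d i) v) (Omega_x lambda m f).

Definition F_d (m : int) : tensor M {poly K} -> tensor M {poly K} :=
  tlift (F_d_tens m).

Definition F_act (x : virasoro K) (q : tensor M {poly K}) : tensor M {poly K} :=
  mlin (fun p => if p is Some m then F_d m q else 0) x.

Definition Br_exp (m : int) : Br K r :=
  \sum_(i < r.+1) (m%:~R ^+ i.+1 / (i.+1)`!%:R) *: Br_d i.

Lemma lact_sum (s : 'I_r.+1 -> K) v :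
  lact (\sum_(i < r.+1) s i *: Br_d i) v
  = \sum_(i < r.+1) s i *: lact (Br_d i) v.
Proof.
have l0 : lact (0 : Br K r) v = 0.
  by have := lactDZl (-1) (0 : Br K r) 0 v; rewrite scaler0 addr0 scaleN1r addNr.
elim: (index_enum _) => [|i t IH]; first by rewrite !big_nil.
by rewrite !big_cons lactDZl IH.
Qed.

Lemma tens0l f : tens (0 : M) f = 0.
Proof. by have := tensDZl (-1) (0 : M) 0 f; rewrite scaler0 addr0 scaleN1r addNr. Qed.

Lemma tens_sum (s : 'I_r.+1 -> K) (u : 'I_r.+1 -> M) f :
  tens (\sum_(i < r.+1) s i *: u i) f = \sum_(i < r.+1) s i *: tens (u i) f.
Proof.
elim: (index_enum _) => [|i t IH]; first by rewrite !big_nil tens0l.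
by rewrite !big_cons tensDZl IH.
Qed.

Lemma F_d_tensE m v f :
  F_d_tens m v f = tens v (Omega_d lambda beta m f)
                   + tens (lact (Br_exp m) v) (Omega_x lambda m f).
Proof. by rewrite /Br_exp lact_sum tens_sum. Qed.

Lemma F_d_bilinear m : bilinear_map (F_d_tens m).
Proof.
split=> a u v w; rewrite !F_d_tensE.
  by rewrite lactDZr !tensDZl scalerDr addrACA.
by rewrite Omega_dDZ Omega_xDZ !tensDZr scalerDr addrACA.
Qed.

Lemma F_dE m v f : F_d m (tens v f) = F_d_tens m v f.
Proof. exact: tlift_tens (F_d_bilinear m) v f. Qed.

Lemma F_dDZ m a p q : F_d m (a *: p + q) = a *: F_d m p + F_d m q.
Proof. exact: tliftDZ (F_d_bilinear m) a p q. Qed.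

Lemma expD_fact (x y : K) N :
  (x + y) ^+ N / N`!%:R
  = \sum_(i < N.+1) x ^+ i / i`!%:R * (y ^+ (N - i) / (N - i)`!%:R).
Proof.
rewrite addrC exprDn mulr_suml; apply: eq_bigr => i _.
have iN : (i <= N)%N by rewrite -ltnS.
have nz k : k`!%:R != 0 :> K by rewrite pnatr_eq0 -lt0n fact_gt0.
rewrite -(bin_fact iN) !natrM -mulr_natr.
have := nz i; have := nz (N - i)%N.
have : ('C(N, i))%:R != 0 :> K by rewrite pnatr_eq0 -lt0n bin_gt0.
by move=> *; field; rewrite ?andbT; repeat (apply/andP; split).
Qed.

Lemma Br_exp_coord m (k : 'I_r.+1) :
  Br_coord (Br_exp m) k = m%:~R ^+ k.+1 / (k.+1)`!%:R.
Proof.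
rewrite Br_coord_sum (bigD1 k) //= big1 ?addr0.
  by rewrite -[_ *: _]addr0 Br_coordDZ Br_coord_d eqxx mulr1 [Br_coord 0 _]mxE addr0.
move=> i /eqP ik; rewrite -[_ *: _]addr0 Br_coordDZ Br_coord_d.
rewrite [Br_coord 0 _]mxE addr0.
by case: eqP => [ki|_]; [case: ik; apply: val_inj | rewrite mulr0].
Qed.

Lemma exp_bracket_coef (x y : K) k :
  \sum_(i < k.+1)
     x ^+ i.+1 / i.+1`!%:R * (y ^+ (k - i).+1 / (k - i).+1`!%:R)
     * ((k - i)%:R - i%:R)
  = (y - x) * ((x + y) ^+ k.+1 / k.+1`!%:R)
    + x * (x ^+ k.+1 / k.+1`!%:R) - y * (y ^+ k.+1 / k.+1`!%:R).
Proof.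
have e (z : K) n : z * (z ^+ n / n`!%:R) = n.+1%:R * (z ^+ n.+1 / n.+1`!%:R).
  rewrite factS natrM exprS.
  have : n`!%:R != 0 :> K by rewrite pnatr_eq0 -lt0n fact_gt0.
  have : n.+1%:R != 0 :> K by rewrite pnatr_eq0.
  move: (n.+1%:R : K) (n`!%:R : K) => a b a0 b0.
  by field; rewrite a0 b0.
set S := LHS; rewrite expD_fact mulrBl.
rewrite [X in y * X - _]big_ord_recl [X in _ - x * X]big_ord_recr /= expr0 fact0 divr1 mul1r subn0 subnn.
rewrite expr0 fact0 divr1 mulr1 !mulrDr.
set A := \sum_(i < k.+1) _; set B := \sum_(i < k.+1) _.
suff -> : S = y * A - x * B by ring.
rewrite /A /B !mulr_sumr -sumrB; apply: eq_bigr => i _.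
have ik : (i <= k)%N by rewrite -ltnS.
rewrite /bump /= add1n subSS subSn // [y * _]mulrCA e [x * _]mulrA e.
by rewrite -!natr1 natrB //; ring.
Qed.

Lemma Br_exp_lie m n :
  lie (Br_exp m) (Br_exp n)
  = (n - m)%:~R *: Br_exp (m + n) + (m%:~R *: Br_exp m - n%:~R *: Br_exp n).
Proof.
apply: Br_coordP => k.
have coordZ a (x : Br K r) : Br_coord (a *: x) k = a * Br_coord x k.
  by rewrite -[a *: x]addr0 Br_coordDZ [Br_coord 0 _]mxE addr0.
have coordB (x y : Br K r) : Br_coord (x - y) k = Br_coord x k - Br_coord y k.
  by rewrite /Br_coord !mxE.
rewrite Br_coordDZ coordB !coordZ !Br_exp_coord.
rewrite rmorphB /= [(m + n)%:~R]rmorphD /=.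
have -> : lie (Br_exp m) (Br_exp n) = Br_lie (Br_exp m) (Br_exp n) by [].
rewrite addrA -exp_bracket_coef Br_coord_sum.
have kr : (k.+1 <= r.+1)%N := ltn_ord k.
pose G i : K := m%:~R ^+ i.+1 / (i.+1)`!%:R *
  (n%:~R ^+ (k - i).+1 / ((k - i).+1)`!%:R) * ((k - i)%:R - i%:R).
rewrite [RHS](big_ord_widen _ G kr) {}/G [RHS]big_mkcond /=; apply: eq_bigr => i _.
rewrite Br_coord_sum; case: ltnP => ik.
  have kir : (k - i < r.+1)%N by rewrite (leq_ltn_trans (leq_subr _ _)).
  rewrite (bigD1 (Ordinal kir)) //= big1 ?addr0.
    rewrite coordZ Br_coord_d !Br_exp_coord /= subnKC // eqxx mulr1.
    by rewrite rmorphB.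
  move=> j /eqP jki; rewrite coordZ Br_coord_d; case: eqP => [kij|_].
    by case: jki; apply: val_inj; rewrite /= kij addKn.
  by rewrite mulr0.
rewrite big1 // => j _; rewrite coordZ Br_coord_d ltn_eqF ?mulr0 //.
exact: leq_trans ik (leq_addr _ _).
Qed.

Lemma commutator_step (W : lmodType K) (a b : K) (x x' y y' z z' : W) :
  x - y = b *: z -> x' - y' = b *: z' ->
  (a *: x + x') - (a *: y + y') = b *: (a *: z + z').
Proof.
move=> xy xy'; rewrite opprD addrACA -scalerBr xy xy' scalerDr !scalerA.
by rewrite mulrC.
Qed.

Lemma commutator_expand (W : zmodType) (a b c d a' b' c' d' : W) :
  (a + b + (c + d)) - (a' + b' + (c' + d'))
  = (a - a') + ((c - b') - (c' - b)) + (d - d').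
Proof.
rewrite !opprD !opprK !addrA.
by rewrite [LHS](ACl (1*5*3*6*7*2*4*8)%AC).
Qed.

Lemma commutator_collect (W : lmodType K) (k : K) (x y z t : W) :
  k *: x + (y - z) + (k *: t + (z - y)) = k *: (x + t).
Proof.
by rewrite addrACA -scalerDr [X in _ + X]addrA subrK subrr addr0.
Qed.

Lemma Omega_dx_comm m n f : lambda != 0 ->
  Omega_d lambda beta m (Omega_x lambda n f)
  - Omega_x lambda n (Omega_d lambda beta m f)
  = n%:~R *: Omega_x lambda (m + n) f.
Proof.
move=> lambda0; rewrite Omega_xd // Omega_dx // [n + m]addrC -mul_polyC.
ring.
Qed.

Hypothesis lambda0 : lambda != 0.

Section AbstractTensor.
Variables (W : lmodType K) (t : M -> {poly K} -> W) (D : int -> W -> W).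
Hypothesis t_bilinear : bilinear_map t.
Hypothesis t_ind : forall P : W -> Prop, P 0 ->
  (forall a p q, P p -> P q -> P (a *: p + q)) ->
  (forall u w, P (t u w)) -> forall q, P q.
Hypothesis D_lin : forall m a p q, D m (a *: p + q) = a *: D m p + D m q.
Hypothesis D_t : forall m v f, D m (t v f) =
  t v (Omega_d lambda beta m f) + t (lact (Br_exp m) v) (Omega_x lambda m f).

Lemma abstract_F_d_lie m n q :
  D m (D n q) - D n (D m q) = (n - m)%:~R *: D (m + n) q.
Proof.
have D0 k : D k 0 = 0.
  by have := D_lin k (-1) 0 0; rewrite scaler0 addr0 scaleN1r addNr.
have DD k p p' : D k (p + p') = D k p + D k p'.
  by rewrite -[p in LHS]scale1r D_lin scale1r.
have [tl tr] := t_bilinear.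
have tBr u g h : t u g - t u h = t u (g - h).
  by rewrite [g - h]addrC -[- h]scaleN1r tr scaleN1r addrC.
have tBl u w g : t u g - t w g = t (u - w) g.
  by rewrite [u - w]addrC -[- w]scaleN1r tl scaleN1r addrC.
have tZr a u g : t u (a *: g) = a *: t u g.
  have t0 : t u 0 = 0.
    by have := tr (-1) u 0 0; rewrite scaler0 addr0 scaleN1r addNr.
  by rewrite -[a *: g]addr0 tr t0 addr0.
elim/t_ind: q => [|a p q Hp Hq|v f]; first by rewrite !D0 scaler0 subrr.
  by rewrite !D_lin; apply: commutator_step.
rewrite !D_t !DD !D_t commutator_expand !tBr.
rewrite Omega_dd // !Omega_dx_comm // !Omega_xx // [n + m]addrC.
rewrite tBl -lact_lie Br_exp_lie lactDZl tl.
rewrite (tZr (n - m)%:~R) (tZr n%:~R) (tZr m%:~R).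
have -> : t (lact (m%:~R *: Br_exp m - n%:~R *: Br_exp n) v) (Omega_x lambda (m + n) f)
  = m%:~R *: t (lact (Br_exp m) v) (Omega_x lambda (m + n) f)
    - n%:~R *: t (lact (Br_exp n) v) (Omega_x lambda (m + n) f).
  have lact0 : lact (0 : Br K r) v = 0.
    by have := lactDZl (-1) (0 : Br K r) 0 v; rewrite scaler0 addr0 scaleN1r addNr.
  rewrite lactDZl tl -[- (_ *: Br_exp n)]scaleNr -[(- _) *: Br_exp n]addr0.
  rewrite lactDZl lact0 addr0 -[_ *: lact _ v]addr0 tl -scaleNr.
  have -> : t 0 (Omega_x lambda (m + n) f) = 0; last by rewrite addr0.
  by have := tl (-1) 0 0 (Omega_x lambda (m + n) f); rewrite scaler0 addr0 scaleN1r addNr.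
exact: commutator_collect.
Qed.

Let A (x : virasoro K) q : W :=
  mlin (fun p => if p is Some m then D m q else 0) x.

Lemma abstract_F_actDZr a x q q' : A x (a *: q + q') = a *: A x q + A x q'.
Proof.
rewrite /A /mlin scaler_sumr -big_split; apply: eq_bigr => -[m|] _ /=.
  by rewrite D_lin scalerDr !scalerA mulrC.
by rewrite !scaler0 addr0.
Qed.

Lemma abstract_F_act_lie x y q : A (lie x y) q = A x (A y q) - A y (A x q).
Proof.
have A0l p : A 0 p = 0 by exact: raddf0.
have A0r z : A z 0 = 0.
  by have := abstract_F_actDZr (-1) z 0 0; rewrite scaler0 addr0 scaleN1r addNr.
have ADl a (z z' : virasoro K) p : A (a *: z + z') p = a *: A z p + A z' p by exact: mlinDZ.
have Ac p : A vc p = 0 by rewrite /A mlinU.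
have Ad m p : A (vd m) p = D m p by rewrite /A mlinU.
have step a (p p' s s' w w' : W) :
    p = s - w -> p' = s' - w' -> a *: p + p' = a *: s + s' - (a *: w + w').
  by move=> -> ->; rewrite opprD addrACA -scalerBr.
elim/malg_ind: x => [|a x x' Hx Hx'|i].
- by rewrite lie0l A0l [A 0 _]A0l A0r subrr.
- by rewrite lieDZl !ADl abstract_F_actDZr; apply: step.
elim/malg_ind: y => [|a y y' Hy Hy'|j].
- by rewrite lie0r A0l [A 0 _]A0l A0r subrr.
- by rewrite lieDZr !ADl abstract_F_actDZr; apply: step.
have -> : lie (<< i >> : virasoro K) << j >> = vir_lie_basis K i j.
  exact: vir_lieE.
case: i j => [m|] [n|] /=; rewrite -?/(vd _) -?/vc.
- rewrite ADl !Ad abstract_F_d_lie -[_ *: vc]addr0 ADl Ac A0l scaler0.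
  by rewrite !addr0.
- by rewrite A0l !Ac A0r subrr.
- by rewrite A0l !Ac A0r subrr.
- by rewrite A0l !Ac subrr.
Qed.

End AbstractTensor.

Let tens_bilinear : bilinear_map (@tens K M {poly K}).
Proof. by split; [exact: tensDZl | exact: tensDZr]. Qed.

Let F_d_tensE' m v f : F_d m (tens v f) =
  tens v (Omega_d lambda beta m f) + tens (lact (Br_exp m) v) (Omega_x lambda m f).
Proof. by rewrite F_dE F_d_tensE. Qed.

Lemma F_actDZl a x y q : F_act (a *: x + y) q = a *: F_act x q + F_act y q.
Proof. exact: mlinDZ. Qed.

Lemma F_actDZr a x p q : F_act x (a *: p + q) = a *: F_act x p + F_act x q.
Proof. exact: (abstract_F_actDZr F_dDZ). Qed.

Lemma F_act_lie x y q :
  F_act (lie x y) q = F_act x (F_act y q) - F_act y (F_act x q).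
Proof.
exact: (abstract_F_act_lie tens_bilinear (@tensor_ind _ _ _) F_dDZ F_d_tensE').
Qed.

Local Notation F := (@Fmod K r M lambda beta lambda0).

HB.instance Definition _ := GRing.Lmodule.on F.
HB.instance Definition _ := Lmodule_isLieModule.Build K (virasoro K)
  F F_actDZl F_actDZr F_act_lie.

Lemma Fmod_vd (m : int) v f :
  lact (vd m) (tens v f : F)
  = tens v (Omega_d lambda beta m f)
    + \sum_(i < r.+1) (m%:~R ^+ i.+1 / (i.+1)`!%:R)
        *: tens (lact (Br_d i) v) (Omega_x lambda m f).
Proof. by rewrite [LHS]mlinU; apply: F_dE. Qed.

Lemma Fmod_vc (q : F) : lact vc q = 0.
Proof. exact: mlinU. Qed.

End Fmod.

Arguments Fmod {K r} M lambda beta lambda0.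

(* Main.v *)
(* Rescaled, lambda^-m d_m acts on q(t) in M[t] as
     t q(t - m) + sum_i m^(i+1) (g_i q)(t - m),
   where g_0 = d_0 - beta and g_i = d_i / (i+1)! for i > 0: a polynomial in m.
   Inverting a Vandermonde matrix, a submodule W contains the coefficient of
   each power of m.  Unless all g_i vanish on M (which forces M = M_beta), take
   the largest s with g_s <> 0; its kernel is a submodule of M, so g_s is
   injective.  For q in W with leading coefficient v in degree n, the top
   coefficient (of m^(n+s+1)) is (-1)^n (g_s v) (x) 1, hence W meets M (x) 1.
   The coefficients for q = u (x) 1 show that {u | u (x) 1 in W} is a submodule
   of M, hence M; and d_0 acts as multiplication by t, so W is everything.
   Conversely F(M_beta, Omega) has the submodule t C[t], the kernel of
   v (x) f |-> f(0) v. *)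

From HB Require Import structures.
Require Import Defs.
From mathcomp Require Import all_boot all_order all_algebra.
From mathcomp Require Import boolp reals complex.

Set Implicit Arguments.
Unset Strict Implicit.
Unset Printing Implicit Defensive.

Import Order.TTheory GRing.Theory Num.Theory.
Local Open Scope ring_scope.
Local Open Scope complex_scope.

(** * Extracting coefficients of polynomials in [m] *)

(** The weights are column [j] of the inverse Vandermonde matrix at the nodes 0, ..., N-1, which are
    distinct in characteristic 0. *)
Lemma vandermonde_dual (K : numFieldType) N (j : 'I_N) :
  exists c : 'I_N -> K,
    forall l : 'I_N, \sum_(m < N) c m * m%:R ^+ l = (l == j)%:R.
Proof.
pose V : 'M[K]_N := Vandermonde N (\row_m m%:R).
have Vu : V \in unitmx.
  rewrite unitmxE det_Vandermonde unitfE; apply/prodf_neq0 => a _.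
  apply/prodf_neq0 => b ab; rewrite !mxE subr_eq0 eqr_nat.
  by rewrite gtn_eqF.
exists (fun m => invmx V m j) => l.
have := congr1 (fun A : 'M[K]_N => A l j) (mulmxV Vu); rewrite !mxE => <-.
by apply: eq_bigr => m _; rewrite !mxE mulrC.
Qed.

Lemma shift1 (K : numFieldType) m : shift m 1 = 1 :> {poly K}.
Proof. exact: rmorph1. Qed.

Lemma shiftXn_expand (K : numFieldType) (m k : nat) :
  shift m 'X^k
  = \sum_(l < k.+1) m%:R ^+ l *: ((-1) ^+ l *: 'X^(k - l) *+ 'C(k, l)) :> {poly K}.
Proof.
rewrite /shift comp_Xn_poly exprDn; apply: eq_bigr => l _.
rewrite -scalerMnr; congr (_ *+ _).
have -> : - (m%:R)%:P = (- m%:R : K)%:P by rewrite polyCN.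
rewrite -polyC_exp mulrC mul_polyC scalerA.
by rewrite (exprNn m%:R) [X in X *: _ = _]mulrC.
Qed.

(** As a polynomial in [m], m^e (t - m)^k has top term (-1)^k m^(e+k). Since [e + k <= j], only this
    term can reach the exponent [j] that the weights select. *)
Lemma weighted_shift (K : numFieldType) N (j : 'I_N) (c : 'I_N -> K) e k :
  (forall l : 'I_N, \sum_(m < N) c m * m%:R ^+ l = (l == j)%:R) ->
  (e + k <= j)%N ->
  \sum_(m < N) c m *: (m%:R ^+ e *: shift m 'X^k)
  = (((e + k)%N == j)%:R * (-1) ^+ k)%:P :> {poly K}.
Proof.
move=> cj ekj.
pose b l : {poly K} := (-1) ^+ l *: 'X^(k - l) *+ 'C(k, l).
transitivity (\sum_(l < k.+1) ((e + l)%N == j)%:R *: b l).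
  under eq_bigr => m _ do rewrite shiftXn_expand !scaler_sumr.
  rewrite exchange_big; apply: eq_bigr => l _ /=.
  have elN : (e + l < N)%N.
    apply: leq_ltn_trans (ltn_ord j); apply: leq_trans ekj.
    by rewrite leq_add2l -ltnS.
  have := cj (Ordinal elN); rewrite -val_eqE /= => <-.
  rewrite scaler_suml; apply: eq_bigr => m _.
  by rewrite !scalerA exprD mulrA.
rewrite big_ord_recr /= big1 ?add0r => [|l _].
  rewrite /b subnn binn mulr1n expr0 scalerA alg_polyC; congr _%:P.
rewrite ltn_eqF ?scale0r //; apply: leq_trans ekj.
by rewrite ltn_add2l.
Qed.

(** [Q i] is the coefficient of m^(i+1); [lift ord0 i] makes this shift by one and skips the
    constant term [P]. *)
Lemma weighted_coef (K : pzRingType) (V : lmodType K) n (c : 'I_n.+1 -> K)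
    (P : V) (Q : 'I_n -> V) (i : 'I_n) :
  (forall l : 'I_n.+1,
     \sum_(m < n.+1) c m * m%:R ^+ l = (l == lift ord0 i)%:R) ->
  \sum_(m < n.+1) c m *: (P + \sum_(k < n) m%:R ^+ k.+1 *: Q k) = Q i.
Proof.
move=> cP; under eq_bigr => m _ do rewrite scalerDr scaler_sumr.
rewrite big_split /= exchange_big /= -scaler_suml.
have := cP ord0; rewrite /=; under eq_bigr do rewrite expr0 mulr1.
move=> ->; rewrite scale0r add0r.
have E (k : 'I_n) : \sum_(m < n.+1) c m *: (m%:R ^+ k.+1 *: Q k) = (k == i)%:R *: Q k.
  under eq_bigr do rewrite scalerA.
  by rewrite -scaler_suml (cP (lift ord0 k)) (inj_eq lift_inj).
under eq_bigr do rewrite E.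
rewrite (bigD1 i) //= eqxx scale1r big1 ?addr0 // => k /negPf->.
by rewrite scale0r.
Qed.

(** * Tensors and their expansion in powers of t *)

Section Bilinear.
Variables (K : comNzRingType) (M N : lmodType K).
Local Notation tens := (@tens K M N).

Lemma tensDr u f g : tens u (f + g) = tens u f + tens u g.
Proof. by rewrite -[f in LHS]scale1r tensDZr scale1r. Qed.

Lemma tensDl u v f : tens (u + v) f = tens u f + tens v f.
Proof. by rewrite -[u in LHS]scale1r tensDZl scale1r. Qed.

Lemma tensr0 u : tens u 0 = 0.
Proof. by apply: (addrI (tens u 0)); rewrite -tensDr !addr0. Qed.

Lemma tensl0 f : tens 0 f = 0.
Proof. by apply: (addrI (tens 0 f)); rewrite -tensDl !addr0. Qed.

Lemma tensZr a u f : tens u (a *: f) = a *: tens u f.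
Proof. by rewrite -[a *: f]addr0 tensDZr tensr0 addr0. Qed.

Lemma tensZl a u f : tens (a *: u) f = a *: tens u f.
Proof. by rewrite -[a *: u]addr0 tensDZl tensl0 addr0. Qed.

Lemma tens_sumr (I : Type) (s : seq I) u (F : I -> N) :
  tens u (\sum_(i <- s) F i) = \sum_(i <- s) tens u (F i).
Proof. by elim: s => [|i s IH]; rewrite ?big_nil ?tensr0 // !big_cons tensDr IH. Qed.

Lemma tens_suml (I : Type) (s : seq I) (F : I -> M) f :
  tens (\sum_(i <- s) F i) f = \sum_(i <- s) tens (F i) f.
Proof. by elim: s => [|i s IH]; rewrite ?big_nil ?tensl0 // !big_cons tensDl IH. Qed.

(** Moves a scalar part of the action on M to the polynomial factor, where it can cancel the beta
    term of Omega. *)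
Lemma tens_regroup u v a b f g :
  b *: (tens u f + tens (a *: u + v) g)
  = tens u (b *: (f + a *: g)) + tens v (b *: g).
Proof. by rewrite tensDZl !tensZr tensDr tensZr addrA scalerDr. Qed.

Lemma tliftD_tens (V : lmodType K) (b : M -> N -> V) u v f g :
  bilinear_map b -> tlift b (tens u f + tens v g) = b u f + b v g.
Proof.
move=> bP; rewrite -[tens u f]scale1r (tliftDZ bP) scale1r.
by rewrite !(tlift_tens bP).
Qed.

End Bilinear.

Lemma tens_poly_expand (K : comNzRingType) (M : lmodType K)
    (q : tensor M {poly K}) :
  exists n, exists v : nat -> M, q = \sum_(k < n) tens (v k) 'X^k.
Proof.
(* Allowing every longer length [N] lets two expansions be padded to a common length and added. *)
suff [n [v]] : exists n, exists v : nat -> M, forall N, (n <= N)%N ->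
    q = \sum_(k < N) tens (v k) 'X^k.
  by exists n, v; apply: p.
elim/tensor_ind: q => [|a p q [n [v pE]] [n' [v' qE]]|u f].
- by exists 0, (fun=> 0) => N _; rewrite big1 // => k _; rewrite tensl0.
- exists (maxn n n'), (fun k => a *: v k + v' k) => N; rewrite geq_max.
  case/andP=> /pE-> /qE->; rewrite scaler_sumr -big_split.
  by apply: eq_bigr => k _; rewrite tensDZl.
- exists (size f), (fun k => f`_k *: u) => N fN.
  under eq_bigr => k _ do rewrite tensZl -tensZr.
  rewrite -tens_sumr; congr tens; apply/polyP => i.
  rewrite -poly_def coef_poly; case: ltnP => // Ni.
  by rewrite nth_default // (leq_trans fN).
Qed.

(** * Closure properties of submodules *)

Section Submodules.
Variables (K : pzRingType) (L : lieAlgType K) (M : lieModType L).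

Lemma lactD (x : L) (u v : M) : lact x (u + v) = lact x u + lact x v.
Proof. by rewrite -[u in LHS]scale1r lactDZr scale1r. Qed.

Lemma lactr0 (x : L) : lact x (0 : M) = 0.
Proof. by apply: (addrI (lact x (0 : M))); rewrite -lactD !addr0. Qed.

Lemma lactZ a (x : L) (v : M) : lact x (a *: v) = a *: lact x v.
Proof. by rewrite -[a *: v]addr0 lactDZr lactr0 addr0. Qed.

Lemma lact0 (v : M) : lact (0 : L) v = 0.
Proof.
apply: (addrI (lact (0 : L) v)); rewrite addr0.
by rewrite -[X in X + _]scale1r -lactDZl scale1r addr0.
Qed.

Lemma lact_sumr (I : Type) (s : seq I) x (F : I -> M) :
  lact x (\sum_(i <- s) F i) = \sum_(i <- s) lact x (F i).
Proof. by elim: s => [|i s IH]; rewrite ?big_nil ?lactr0 // !big_cons lactD IH. Qed.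

Variables (W : M -> Prop).
Hypothesis Wsub : lie_submodule W.

Lemma submod0 : W 0. Proof. by case: Wsub. Qed.

Lemma submodD u v : W u -> W v -> W (u + v).
Proof. by case: Wsub => _ WD _ Wu Wv; rewrite -[u]scale1r; apply: WD. Qed.

Lemma submodZ a u : W u -> W (a *: u).
Proof. by case: Wsub => W0 WD _ Wu; rewrite -[_ *: _]addr0; apply: WD. Qed.

Lemma submod_sum (I : Type) (s : seq I) (F : I -> M) :
  (forall i, W (F i)) -> W (\sum_(i <- s) F i).
Proof.
by move=> WF; elim/big_ind: _ => //; [exact: submod0 | exact: submodD].
Qed.

Lemma submod_irr v : lie_irreducible M -> v <> 0 -> W v -> forall u, W u.
Proof.
move=> [_ irr] v0 Wv u; apply: contrapT => Wu; apply: irr.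
by exists W; split=> //; [exists v | exists u].
Qed.

End Submodules.

(** * The operators g_i and the action of d_m as a polynomial in m *)

Section Reducibility.
Variables (K : numFieldType) (r : nat) (M : lieModType (Br K r)).
Variables (lambda beta : K) (lambda0 : lambda != 0).
Local Notation F := (Fmod M lambda beta lambda0).

(* The coefficient of m^(i+1) in the [M]-part of lambda^-m d_m. *)
Definition dcoef (i : nat) (v : M) : M :=
  (i.+1)`!%:R^-1 *: lact (Br_d i) v - (beta *+ (i == 0)%N) *: v.

Lemma Br_dE i (v : M) :
  lact (Br_d i) v = (i.+1)`!%:R *: (dcoef i v + (beta *+ (i == 0)%N) *: v).
Proof.
by rewrite subrK scalerA mulfV ?scale1r // pnatr_eq0 -lt0n fact_gt0.
Qed.

Lemma dcoef_eq0 i : (r < i)%N -> forall v, dcoef i v = 0.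
Proof.
move=> ri v; rewrite /dcoef Br_d0 // lact0 scaler0 gtn_eqF ?(leq_ltn_trans _ ri) //.
by rewrite mulr0n scale0r subrr.
Qed.

Lemma lact_Br_d_comm i j (v : M) :
  lact (Br_d i) (lact (Br_d j) v)
  = lact (Br_d j) (lact (Br_d i) v)
    + (j%:Z - i%:Z)%:~R *: lact (Br_d (i + j)) v.
Proof.
have E : lie (Br_d i : Br K r) (Br_d j) = (j%:Z - i%:Z)%:~R *: Br_d (i + j) + 0.
  by rewrite addr0; exact: Br_lieE.
have := lact_lie (Br_d i : Br K r) (Br_d j) v.
by rewrite E lactDZl lact0 addr0 => ->; rewrite addrC subrK.
Qed.

Lemma lact_Br_exp m v :
  lact (Br_exp K r m) v
  = (m%:~R * beta) *: v + \sum_(i < r.+1) m%:~R ^+ i.+1 *: dcoef i v.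
Proof.
rewrite lact_sum; under eq_bigr => i _ do
  rewrite Br_dE scalerA divfK ?pnatr_eq0 -?lt0n ?fact_gt0 // scalerDr scalerA.
rewrite big_split /= addrC big_ord_recl /= big1 ?addr0 => [|i _].
  by rewrite expr1 mulr1n.
by rewrite mulr0n mulr0 scale0r.
Qed.

Lemma F_d_tens_dcoef (m : int) v f :
  lambda ^ (- m) *: F_d_tens lambda beta m v f
  = tens v ('X * shift m f)
    + \sum_(i < r.+1) m%:~R ^+ i.+1 *: tens (dcoef i v) (shift m f).
Proof.
have lm : lambda ^ (- m) * lambda ^ m = 1 by rewrite -expfzDr // addNr expr0z.
rewrite F_d_tensE lact_Br_exp tens_regroup tens_suml Omega_dE.
(* The m beta split off from d_0 cancels the one in t - m beta, leaving the factor t. *)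
rewrite -[(_ * beta) *: _]mul_polyC -mulrDl subrK scalerAr.
rewrite {1 2}/Omega_x scalerA lm scale1r.
congr (_ + _).
by apply: eq_bigr => i _; rewrite tensZl.
Qed.

Lemma vd_tens (m : int) v f :
  lambda ^ (- m) *: lact (vd m) (tens v f : F)
  = tens v ('X * shift m f)
    + \sum_(i < r.+1) m%:~R ^+ i.+1 *: tens (dcoef i v) (shift m f).
Proof. by rewrite Fmod_vd; exact: F_d_tens_dcoef. Qed.

(** The terms t (t - m)^k have degree at most n in m, and m^(i+1) (t - m)^k has degree i+1+k. With i
    <= s and k <= n, the exponent n+s+1 is reached only at i = s, k = n. *)
Lemma vd_top n s (v : nat -> M) (c : 'I_(n + s.+1).+1 -> K) :
  (forall l : 'I_(n + s.+1).+1,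
     \sum_(m < (n + s.+1).+1) c m * m%:R ^+ l = (l == ord_max)%:R) ->
  (forall i u, (s < i)%N -> dcoef i u = 0) ->
  \sum_(m < (n + s.+1).+1) c m *: (lambda ^ (- m%:Z) *:
    lact (vd m) (\sum_(k < n.+1) tens (v k) 'X^k : F))
  = tens (dcoef s (v n)) ((-1) ^+ n)%:P.
Proof.
move=> cP gs.
have wX e k : (e + k <= n + s.+1)%N ->
  \sum_(m < (n + s.+1).+1) c m *: (m%:R ^+ e *: shift m 'X^k)
  = (((e + k)%N == (n + s.+1)%N)%:R * (-1) ^+ k)%:P :> {poly K}.
  exact: (weighted_shift cP).
have wX0 k u : (k <= n)%N ->
  \sum_(m < (n + s.+1).+1) c m *: tens u ('X * shift m 'X^k) = 0 :> F.
  move=> kn; under eq_bigr => m _ do rewrite -tensZr scalerAr.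
  rewrite -tens_sumr -mulr_sumr.
  have := wX 0 k; under eq_bigr => m _ do rewrite expr0 scale1r.
  move=> ->; last by rewrite add0n (leq_trans kn) // leq_addr.
  rewrite add0n ltn_eqF ?mul0r ?polyC0 ?mulr0 ?tensr0 //.
  by rewrite addnS ltnS (leq_trans kn) ?leq_addr.
have wE i k u : (k <= n)%N ->
  \sum_(m < (n + s.+1).+1) c m *: (m%:R ^+ i.+1 *: tens (dcoef i u) (shift m 'X^k))
  = ((i == s) && (k == n))%:R *: tens (dcoef i u) ((-1) ^+ n)%:P :> F.
  move=> kn; case: (ltnP s i) => [si|is_].
    by rewrite gs // big1 ?tensl0 ?scaler0 // => m _; rewrite tensl0 !scaler0.
  under eq_bigr => m _ do rewrite -!tensZr.
  rewrite -tens_sumr wX; last by rewrite addnC leq_add.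
  have -> : (i.+1 + k == n + s.+1)%N = (i == s) && (k == n).
    apply/eqP/andP => [E|[/eqP-> /eqP->]]; last by rewrite addnC.
    have Eis : i = s; last first.
      by split; apply/eqP => //; move: E; rewrite Eis addnC => /addIn.
    apply/eqP; rewrite eqn_leq is_ /= leqNgt; apply/negP => lis.
    by have := leq_add lis kn; rewrite E addnS [(n + s)%N]addnC ltnn.
  case: andP => [[_ /eqP->]|_]; last by rewrite mul0r polyC0 tensr0 scale0r.
  by rewrite mul1r scale1r.
under eq_bigr => m _ do rewrite lact_sumr !scaler_sumr.
rewrite exchange_big big_ord_recr /= big1 ?add0r => [|k _].
  under eq_bigr => m _ do rewrite vd_tens scalerDr scaler_sumr.
  rewrite big_split /= wX0 // add0r exchange_big /=.
  under eq_bigr => i _ do rewrite wE // eqxx andbT.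
  (* For [s > r] both sides vanish; otherwise [s] is an index of the sum. *)
  case: (ltnP r s) => [rs|sr].
    rewrite dcoef_eq0 // tensl0 big1 // => i _.
    by rewrite ltn_eqF ?scale0r // (leq_ltn_trans _ rs) // -ltnS.
  rewrite (bigD1 (Ordinal (sr : (s < r.+1)%N))) //= eqxx scale1r big1 ?addr0 // => i.
  by rewrite -val_eqE /= => /negPf->; rewrite scale0r.
under eq_bigr => m _ do rewrite vd_tens scalerDr scaler_sumr.
rewrite big_split /= wX0 ?add0r; last by rewrite ltnW.
rewrite exchange_big /= big1 // => i _.
by rewrite wE ?(ltnW (ltn_ord k)) // [(k : nat) == n]ltn_eqF // andbF scale0r.
Qed.

Lemma vd0_tens v f : lact (vd 0) (tens v f : F) = tens v ('X * f).
Proof.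
have := vd_tens 0 v f; rewrite oppr0 expr0z scale1r => ->.
have -> : shift 0 f = f by rewrite /shift subr0 comp_polyXr.
by rewrite big1 ?addr0 // => i _; rewrite expr0n scale0r.
Qed.

(** Shifts fix 1, so the powers of m come from the g_i alone and each g_i can be isolated. *)
Lemma vd_tens1 (c : 'I_r.+2 -> K) (i : 'I_r.+1) v :
  (forall l : 'I_r.+2,
     \sum_(m < r.+2) c m * m%:R ^+ l = (l == lift ord0 i)%:R) ->
  \sum_(m < r.+2) c m *: (lambda ^ (- m%:Z) *: lact (vd m) (tens v 1 : F))
  = tens (dcoef i v) 1.
Proof.
move=> cP; under eq_bigr => m _ do rewrite vd_tens shift1 mulr1.
exact: (weighted_coef _ (fun i : 'I_r.+1 => tens (dcoef i v) 1) cP).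
Qed.

(** * The g_i on an irreducible M *)

Lemma dcoefDZ i a u v : dcoef i (a *: u + v) = a *: dcoef i u + dcoef i v.
Proof.
rewrite /dcoef lactDZr !scalerDr !scalerN !scalerA opprD [_ * a]mulrC.
by rewrite [_ * a]mulrC addrACA.
Qed.

Lemma dcoef0 i : dcoef i 0 = 0.
Proof. by rewrite /dcoef lactr0 !scaler0 subrr. Qed.

Lemma dcoef_submodule (U : M -> Prop) :
  U 0 -> (forall a u v, U u -> U v -> U (a *: u + v)) ->
  (forall i v, U v -> U (dcoef i v)) -> lie_submodule U.
Proof.
move=> U0 UD Ug; split=> // x v Uv; elim/Br_ind: x => [|a x y Ux Uy|k].
- by rewrite lact0.
- by rewrite lactDZl; apply: UD.
rewrite Br_dE -[_ *: _]addr0; apply: (UD) => //.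
by rewrite addrC; apply: UD => //; apply: Ug.
Qed.

(** On the kernel, g_s commutes with every d_k: the commutator is a multiple of (k - s) d_(s+k),
    which vanishes there by [dsk0]. *)
Lemma dcoef_ker_submodule s :
  (forall i v, (s < i)%N -> dcoef i v = 0) ->
  lie_submodule (fun v => dcoef s v = 0).
Proof.
move=> gs; split=> [|a u v|x v gv]; first exact: dcoef0.
  by rewrite dcoefDZ => -> ->; rewrite scaler0 addr0.
elim/Br_ind: x => [|a x y gx gy|k].
- by rewrite lact0 dcoef0.
- by rewrite lactDZl dcoefDZ gx gy scaler0 addr0.
have dsk0 : (k%:Z - s%:Z)%:~R *: lact (Br_d (s + k)) v = 0.
  (* If s = k = 0 the factor k - s is zero. Otherwise d_(s+k) is a multiple of g_(s+k), which kills
     v by hypothesis on v for k = 0 and by maximality of s for k > 0. *)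
  case: (posnP (s + k)) => [/eqP|sk].
    by rewrite addn_eq0 => /andP[/eqP-> /eqP->]; rewrite scale0r.
  rewrite Br_dE gtn_eqF // mulr0n scale0r addr0.
  suff -> : dcoef (s + k) v = 0 by rewrite !scaler0.
  by case: k sk => [|k _]; rewrite ?addn0 // gs // addnS ltnS leq_addr.
suff -> : dcoef s (lact (Br_d k) v) = lact (Br_d k) (dcoef s v).
  by rewrite gv lactr0.
by rewrite /dcoef -!scaleNr lactD !lactZ lact_Br_d_comm dsk0 addr0.
Qed.

Lemma dcoef_inj s v :
  lie_irreducible M -> (forall i u, (s < i)%N -> dcoef i u = 0) ->
  (exists u, dcoef s u <> 0) -> dcoef s v = 0 -> v = 0.
Proof.
move=> irr gs [u gu] gv; apply: contrapT => v0.
exact: gu (submod_irr (dcoef_ker_submodule gs) irr v0 gv u).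
Qed.

Lemma dcoef_top :
  (exists i v, dcoef i v <> 0) ->
  exists s, (exists v, dcoef s v <> 0) /\
    forall i v, (s < i)%N -> dcoef i v = 0.
Proof.
move=> [i [v giv]].
pose P s := `[< exists v, dcoef s v <> 0 >].
have exP : exists s, P s by exists i; apply/asboolP; exists v.
have Pr s : P s -> (s <= r)%N.
  move=> /asboolP[u gu]; rewrite leqNgt; apply/negP => rs.
  by apply: gu; rewrite dcoef_eq0.
case: (ex_maxnP exP Pr) => s /asboolP gs smax; exists s; split=> // k u sk.
apply: contrapT => gk; have := smax k; rewrite leqNgt sk => /implyP.
by rewrite implybF; move/asboolP; apply; exists u.
Qed.

(** All of B_r acts by scalars, so every line is a submodule and M is one-dimensional; the
    isomorphism is the coordinate along a nonzero [v]. *)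
Lemma iso_of_dcoef_eq0 :
  lie_irreducible M -> (forall i v, dcoef i v = 0) ->
  lie_isomorphic M (Mgamma r beta).
Proof.
move=> irr g0; have [[v /eqP v0] _] := irr.
have actE x (u : M) : lact x u = (beta * Br_coord x ord0) *: u.
  elim/Br_ind: x => [|a x y Hx Hy|k].
  - by rewrite lact0 /Br_coord mxE mulr0 scale0r.
  - by rewrite lactDZl Hx Hy Br_coordDZ mulrDr scalerDl scalerA mulrCA.
  - rewrite Br_dE g0 add0r scalerA Br_coord_d eq_sym.
    by case: k => [|k]; rewrite /= ?mulr1n ?mul1r ?mulr1 // mulr0n !mulr0.
have line : lie_submodule (fun u : M => exists a, u = a *: v).
  split=> [|a _ _ [b ->] [c ->]|x _ [b ->]].
  - by exists 0; rewrite scale0r.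
  - by exists (a * b + c); rewrite scalerDl scalerA.
  - by rewrite actE scalerA; eexists.
have all_line (u : M) : exists a, u = a *: v.
  apply: (submod_irr line irr (v := v)); first exact/eqP.
  by exists 1; rewrite scale1r.
pose f (u : M) : Mgamma r beta := sval (cid (all_line u)).
have fE u : u = (f u : K) *: v by exact: svalP (cid (all_line u)).
have vI : injective (fun a : K => a *: v).
  move=> a b /eqP; rewrite -subr_eq0 -scalerBl scaler_eq0 (negPf v0) orbF.
  by rewrite subr_eq0 => /eqP.
have fL : linear f.
  move=> a u w; apply: vI => /=; rewrite -fE.
  by rewrite {1}[u]fE {1}[w]fE scalerA -scalerDl.
pose fl : {linear M -> Mgamma r beta} := HB.pack f (GRing.isLinear.Build _ _ _ _ f fL).
exists fl; split=> [|x u]; last by rewrite actE linearZ.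
exists (fun a => (a : K) *: v) => [u|a]; first exact/esym/fE.
by apply: vI; rewrite -fE.
Qed.

Lemma leading_tens (q : F) : q <> 0 ->
  exists n (v : nat -> M), v n <> 0 /\ q = \sum_(k < n.+1) tens (v k) 'X^k.
Proof.
have [n [v ->]] := tens_poly_expand q.
elim: n => [|n IH]; first by rewrite big_ord0.
have [vn0|vn0 _] := pselect (v n = 0); last by exists n, v.
by rewrite big_ord_recr /= vn0 tensl0 addr0.
Qed.

(** * Nonzero submodules of F when some g_i is nonzero *)

Section Submodule.
Variable W : F -> Prop.
Hypothesis Wsub : lie_submodule W.

Lemma submod_weighted n (c : 'I_n -> K) q : W q ->
  W (\sum_(m < n) c m *: (lambda ^ (- m%:Z) *: lact (vd m) q)).
Proof.
move=> Wq; apply: (submod_sum Wsub) => m.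
by do 2!apply: (submodZ Wsub); case: Wsub => _ _; apply.
Qed.

Lemma submod_tens1 : lie_irreducible M -> (exists i v, dcoef i v <> 0) ->
  (exists2 q, W q & q <> 0) -> exists2 v, W (tens v 1) & v <> 0.
Proof.
move=> irr /dcoef_top[s [gs0 gs]] [q Wq /leading_tens[n [v [vn0 qE]]]].
have [c cP] := vandermonde_dual K (@ord_max (n + s.+1)).
have := submod_weighted c Wq; rewrite qE (vd_top _ cP gs) => Wt.
exists (dcoef s (v n)) => [|gv0]; last exact/vn0/(dcoef_inj irr gs gs0 gv0).
(* Multiplying by (-1)^n again removes the sign. *)
have := submodZ Wsub ((-1) ^+ n) Wt; rewrite -tensZr -mul_polyC -polyCM.
by rewrite -exprMn mulrNN mulr1 expr1n.
Qed.

Lemma tens1_submodule : lie_submodule (fun v => W (tens v 1)).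
Proof.
have [W0 WD _] := Wsub; apply: dcoef_submodule => [|a u v Wu Wv|k v Wv].
- by rewrite tensl0.
- by rewrite tensDZl; apply: WD.
case: (ltnP r k) => [rk|kr]; first by rewrite dcoef_eq0 // tensl0.
have [c cP] := vandermonde_dual K (lift ord0 (Ordinal (kr : (k < r.+1)%N))).
by have := submod_weighted c Wv; rewrite (vd_tens1 _ cP).
Qed.

Lemma submod_all : lie_irreducible M -> (exists i v, dcoef i v <> 0) ->
  (exists2 q, W q & q <> 0) -> forall q, W q.
Proof.
move=> irr g0 Wne q; have [v Wv v0] := submod_tens1 irr g0 Wne.
have W1 := submod_irr tens1_submodule irr v0 Wv.
have WX u k : W (tens u 'X^k).
  elim: k => [|k IH]; first by rewrite expr0; apply: W1.
  by rewrite exprS -vd0_tens; case: Wsub => _ _; apply.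
have [n [w ->]] := tens_poly_expand q.
by apply: (submod_sum Wsub) => k; apply: WX.
Qed.

End Submodule.

Lemma iso_of_reducible :
  lie_irreducible M -> lie_reducible F -> lie_isomorphic M (Mgamma r beta).
Proof.
move=> irr [W [Wsub Wne [q Wq]]]; apply: (iso_of_dcoef_eq0 irr) => i v.
apply: contrapT => giv; apply: Wq; apply: (submod_all Wsub) => //.
by exists i, v.
Qed.

Lemma reducible_of_iso :
  lie_irreducible M -> lie_isomorphic M (Mgamma r beta) -> lie_reducible F.
Proof.
move=> [[v v0] _] [f [fb fact]].
pose ev k (u : M) (p : {poly K}) : K^o := p`_k * (f u : K).
have evb k : bilinear_map (ev k).
  split=> a u w p; rewrite /ev.
    by rewrite linearP mulrDr mulrCA.
  by rewrite coefD coefZ mulrDl -mulrA.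
have fv0 : (f v : K) != 0.
  apply/eqP => fv; apply: v0; apply: (bij_inj fb); rewrite fv; exact/esym/linear0.
pose W (q : F) := tlift (ev 0) q = 0.
have WZD a (p q : F) : W p -> W q -> W (a *: p + q).
  by rewrite /W (tliftDZ (evb 0)) => -> ->; rewrite scaler0 addr0.
have W0 : W 0.
  have := tliftDZ (evb 0) (-1) 0 0; rewrite scaler0 addr0 scaleN1r addNr; exact.
have WF m u p : W (F_d_tens lambda beta m u p).
  rewrite /W F_d_tensE tliftD_tens // /ev fact Omega_dE -!horner_coef0 hornerM.
  rewrite hornerXsubC sub0r.
  have -> : lact (Br_exp K r m) (f u) = (m%:~R * beta) * f u :> K.
    transitivity ((beta * Br_coord (Br_exp K r m) ord0) * f u) => //.
    by rewrite Br_exp_coord expr1 divr1 [beta * _]mulrC.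
  by rewrite !mulNr mulrCA mulrA addNr.
exists W; split.
- split=> // x q _; elim/malg_ind: x => [|a x y Wx Wy|[m|]].
  + by rewrite lact0.
  + by rewrite lactDZl; apply: WZD.
  + elim/tensor_ind: q => [|a p q Wp Wq|u p].
    * by rewrite lactr0.
    * by rewrite lactDZr; apply: WZD.
    * by rewrite [X in W X]Fmod_vd; apply: WF.
  + by rewrite [X in W X]Fmod_vc.
- exists (tens v 'X); first by rewrite /W (tlift_tens (evb 0)) /ev coefX mul0r.
  move=> vX; have := tlift_tens (evb 1%N) v 'X; rewrite vX /ev coefX mul1r => E.
  have := tliftDZ (evb 1%N) (-1) 0 0; rewrite scaler0 addr0 scaleN1r addNr E.
  by move/eqP; rewrite (negPf fv0).
- exists (tens v 1); rewrite /W (tlift_tens (evb 0)) /ev coef1 mul1r.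
  by move/eqP; rewrite (negPf fv0).
Qed.

End Reducibility.

Theorem theorem3p2 (R : realType) (r : nat) (M : lieModType (Br R[i] r))
    (lambda beta : R[i]) (lambda0 : lambda != 0) :
  lie_irreducible M ->
  (lie_reducible (Fmod M lambda beta lambda0)
   <-> lie_isomorphic M (Mgamma r beta)).
Proof.
by move=> irr; split; [exact: iso_of_reducible | exact: reducible_of_iso].
Qed.
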